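(* Let $A$ be any algebra. A collection of recognizable subsets of $A$ is a Boolean subalgebra of $\mathrm{Rec}(A)$ if and only if it can be defined by a set of (profinite) symmetric lattice equations for $A$; that is, if and only if there is a set $\Sigma\subseteq\widehat A\times\widehat A$ such that the collection consists exactly of those $L\in\mathrm{Rec}(A)$ that satisfy $x\leftrightarrow y$ for every $(x,y)\in\Sigma$.
   Context: $A$ is an algebra of some (finitary) type $\tau$. A subset $L\subseteq A$ is recognizable if $L=\varphi^{-1}(P)$ for some homomorphism $\varphi:A\to F$ into a finite algebra $F$ of type $\tau$ and some $P\subseteq F$; $\mathrm{Rec}(A)$ is the Boolean algebra of recognizable subsets. The profinite completion $\widehat{A}$ is the inverse limit, as a topological algebra, of the finite discrete algebras $A/\theta$, $\theta$ ranging over the congruences of $A$ of finite index. A point $x=(x_\theta)_\theta\in\widehat A$ is identified with the prime filter $F_x$ of $\mathrm{Rec}(A)$ such that, for $L=q_\theta^{-1}(P)$ with $q_\theta:A\to A/\theta$ the quotient map and $P\subseteq A/\theta$, $L\in F_x\iff x_\theta\in P$. For $x,y\in\widehat A$, $L$ satisfies the profinite lattice equation $x\to y$ iff ($L\in F_y$ implies $L\in F_x$). The symmetric lattice equation $x\leftrightarrow y$ is the conjunction of $x\to y$ and $y\to x$. *)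

(* Defs.v *)
From HB Require Import structures.
From mathcomp Require Import all_boot all_classical topology function_spaces.

Set Implicit Arguments.
Unset Strict Implicit.
Unset Printing Implicit Defensive.

Local Open Scope classical_set_scope.

(* Nullary symbols, infinitely many symbols and empty carriers are allowed. *)
Record signature := Signature { symbol :> Type; arity : symbol -> nat }.

Record algebra (tau : signature) := Algebra {
  carrier :> Type;
  interp : forall f : tau, ('I_(arity f) -> carrier) -> carrier }.

Definition is_hom (tau : signature) (A B : algebra tau) (phi : A -> B) : Prop :=
  forall (f : tau) (a : 'I_(arity f) -> A),
    phi (interp a) = interp (fun i => phi (a i)).

Definition finite_algebra (tau : signature) (F : algebra tau) : Prop :=
  finite_set [set: F].

Definition Rec (tau : signature) (A : algebra tau) : set (set A) :=
  [set L | exists (F : algebra tau) (phi : A -> F) (P : set F),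
     [/\ finite_algebra F, is_hom phi & L = phi @^-1` P]].

Record congruence (tau : signature) (A : algebra tau) := Congruence {
  congr_rel :> A -> A -> Prop;
  congr_refl : forall a, congr_rel a a;
  congr_sym : forall a b, congr_rel a b -> congr_rel b a;
  congr_trans : forall a b c, congr_rel a b -> congr_rel b c -> congr_rel a c;
  congr_compat : forall (f : tau) (a b : 'I_(arity f) -> A),
    (forall i, congr_rel (a i) (b i)) -> congr_rel (interp a) (interp b) }.

Section Quotient.
Context (tau : signature) (A : algebra tau) (theta : congruence A).

Definition congr_class (a : A) : set A := [set b | theta a b].

Definition quot_carrier : Type := {C : set A | exists a, C = congr_class a}.

Definition quot_class (a : A) : quot_carrier :=
  exist _ (congr_class a) (ex_intro _ a erefl).

Definition quot_repr (C : quot_carrier) : A := projT1 (cid (proj2_sig C)).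

Definition quotient : algebra tau :=
  @Algebra tau quot_carrier
    (fun f c => quot_class (interp (fun i => quot_repr (c i)))).

Definition quot_map : A -> quotient := quot_class.

Lemma quot_map_eq (a b : A) : quot_map a = quot_map b <-> theta a b.
Proof.
split=> [/(congr1 (@proj1_sig _ _)) /= e|ab].
  have : congr_class b b by exact: congr_refl.
  by rewrite -e.
apply: eq_exist => /=; apply/seteqP; split=> c /=.
- exact/congr_trans/congr_sym.
- exact: congr_trans ab.
Qed.

Lemma quot_reprK (C : quotient) : quot_map (quot_repr C) = C.
Proof.
case: C => C p; apply: eq_exist => /=.
by rewrite /quot_repr /=; case: cid.
Qed.

Lemma quot_map_hom : is_hom quot_map.
Proof.
move=> f a; apply/quot_map_eq; apply: congr_compat => i.
by apply/quot_map_eq; rewrite quot_reprK.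
Qed.

End Quotient.

Record fin_congruence (tau : signature) (A : algebra tau) := FinCongruence {
  fin_congr :> congruence A;
  fin_congrP : finite_algebra (quotient fin_congr) }.

(* The transition map A/theta -> A/theta' of the inverse system; it is only
   meaningful when theta is contained in theta'. *)
Definition transition (tau : signature) (A : algebra tau)
    (theta theta' : congruence A) (C : quotient theta) : quotient theta' :=
  quot_map theta' (quot_repr C).

Lemma transitionE (tau : signature) (A : algebra tau)
    (theta theta' : congruence A) (a : A) :
  (forall b c, theta b c -> theta' b c) ->
  transition theta' (quot_map theta a) = quot_map theta' a.
Proof.
by move=> sub; apply/quot_map_eq/sub/quot_map_eq; rewrite quot_reprK.
Qed.

Lemma transition_hom (tau : signature) (A : algebra tau)
    (theta theta' : congruence A) :
  (forall b c, theta b c -> theta' b c) ->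
  is_hom (@transition tau A theta theta').
Proof.
by move=> sub f c; rewrite [LHS]transitionE// quot_map_hom.
Qed.

Section ProfiniteCompletion.
Context (tau : signature) (A : algebra tau).

Definition is_thread (x : forall theta : fin_congruence A, quotient theta) :=
  forall theta theta' : fin_congruence A,
    (forall a b, theta a b -> theta' a b) ->
    transition theta' (x theta) = x theta'.

Definition thread : Type :=
  {x : forall theta : fin_congruence A, quotient theta | is_thread x}.

Definition coord (x : thread) (theta : fin_congruence A) : quotient theta :=
  proj1_sig x theta.

Lemma interp_is_thread (f : tau) (x : 'I_(arity f) -> thread) :
  is_thread (fun theta => interp (fun i => coord (x i) theta)).
Proof.
move=> theta theta' sub; rewrite transition_hom//; congr (interp _).
by apply/funext => i; exact: (proj2_sig (x i)).
Qed.

Definition profinite_completion : algebra tau :=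
  @Algebra tau thread (fun f x => exist _ _ (interp_is_thread x)).

HB.instance Definition _ (theta : congruence A) :=
  gen_eqMixin (quot_carrier theta).
HB.instance Definition _ (theta : congruence A) :=
  gen_choiceMixin (quot_carrier theta).
HB.instance Definition _ := gen_eqMixin (fin_congruence A).
HB.instance Definition _ := gen_eqMixin thread.
HB.instance Definition _ := gen_choiceMixin thread.

Definition discrete_product : Type :=
  forall theta : fin_congruence A, discrete_topology (quot_carrier theta).
HB.instance Definition _ := Topological.copy discrete_product
  (prod_topology
    (fun theta : fin_congruence A => discrete_topology (quot_carrier theta))).

Definition thread_val (x : thread) : discrete_product := coord x.

HB.instance Definition _ :=
  Topological.copy thread (initial_topology thread_val).

(* Makes profinite_completion A a topological algebra. *)
Lemma interp_continuous (f : tau) :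
  continuous ((fun x => @interp tau profinite_completion f x) :
    prod_topology (fun _ : 'I_(arity f) => thread) -> thread).
Proof.
apply: continuous_comp_initial => x.
have Fx : Filter (nbhs (x : prod_topology (fun _ : 'I_(arity f) => thread))).
  exact: nbhs_filter.
apply/cvg_sup => theta.
move=> U [_ [[W _ <-] Wx] /filterS]; apply.
have near_coord (i : 'I_(arity f)) :
    \forall y \near (x : prod_topology (fun _ : 'I_(arity f) => thread)),
      coord (y i) theta = coord (x i) theta.
  have cthread : continuous (fun z : thread =>
      coord z theta : discrete_topology (quot_carrier theta)).
    move=> z.
    apply: (@continuous_comp _ _ _ thread_val (fun g => g theta)).
      exact: initial_continuous.
    exact: (@proj_continuous _
      (fun t : fin_congruence A => discrete_topology (quot_carrier t)) theta).
  have ci := @proj_continuous _ (fun _ : 'I_(arity f) => thread) i x.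
  exact: (continuous_comp ci (@cthread _) (discrete_set1 _)).
have nx := filter_forall Fx near_coord.
apply: filterS nx => y yx.
rewrite /preimage /= in Wx *; move: Wx.
rewrite /thread_val /coord /=; congr (W _); congr (quot_class _ _).
congr (interp _); apply/funext => i.
by rewrite -[LHS]/(quot_repr (coord (x i) theta)) -yx.
Qed.

(* F_x; point_filterE below shows that membership does not depend on the
   presentation of L as a preimage under a quotient map. *)
Definition point_filter (x : profinite_completion) : set (set A) :=
  [set L | exists (theta : fin_congruence A) (P : set (quotient theta)),
     L = quot_map theta @^-1` P /\ P (coord x theta)].

Lemma fin_congruenceI (theta theta' : fin_congruence A) :
  exists rho : fin_congruence A,
    forall a b, rho a b <-> theta a b /\ theta' a b.
Proof.
have refl a : theta a a /\ theta' a a by split; exact: congr_refl.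
have sym a b : theta a b /\ theta' a b -> theta b a /\ theta' b a.
  by move=> [? ?]; split; exact: congr_sym.
have trans a b c : theta a b /\ theta' a b -> theta b c /\ theta' b c ->
    theta a c /\ theta' a c.
  by move=> [? ?] [? ?]; split; [exact: (@congr_trans _ _ _ a b)|
    exact: (@congr_trans _ _ _ a b)].
have compat (f : tau) (a b : 'I_(arity f) -> A) :
    (forall i, theta (a i) (b i) /\ theta' (a i) (b i)) ->
    theta (interp a) (interp b) /\ theta' (interp a) (interp b).
  by move=> h; split; apply: congr_compat => i; have [] := h i.
pose rho := Congruence refl sym trans compat.
suff fin : finite_algebra (quotient rho) by exists (FinCongruence fin).
pose j (C : quotient rho) :=
  (quot_map theta (quot_repr C), quot_map theta' (quot_repr C)).
have /(@finite_preimage _ _ _ j) :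
    finite_set ([set: quotient theta] `*` [set: quotient theta']).
  by apply: finite_setX; exact: fin_congrP.
rewrite /finite_algebra (_ : _ @^-1` _ = setT); last first.
  by apply/seteqP; split.
apply=> C D _ _ CD.
have /quot_map_eq e : quot_map theta _ = quot_map theta _ := congr1 fst CD.
have /quot_map_eq e' : quot_map theta' _ = quot_map theta' _ := congr1 snd CD.
by rewrite -(quot_reprK C) -(quot_reprK D); apply/quot_map_eq.
Qed.

Lemma point_filterE (x : profinite_completion) (theta : fin_congruence A)
    (P : set (quotient theta)) :
  point_filter x (quot_map theta @^-1` P) <-> P (coord x theta).
Proof.
split=> [[theta' [P' [e P'x]]]|Px]; last by exists theta, P.
have [rho rhoE] := fin_congruenceI theta theta'.
have sub a b : rho a b -> theta a b by move=> /rhoE [].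
have sub' a b : rho a b -> theta' a b by move=> /rhoE [].
move: P'x; rewrite /coord -(proj2_sig x _ _ sub) -(proj2_sig x _ _ sub').
by rewrite -[P' _]/((quot_map theta' @^-1` P') _) -e.
Qed.

End ProfiniteCompletion.

Definition lattice_eq (tau : signature) (A : algebra tau)
    (x y : profinite_completion A) (L : set A) : Prop :=
  point_filter y L -> point_filter x L.

Definition symmetric_lattice_eq (tau : signature) (A : algebra tau)
    (x y : profinite_completion A) (L : set A) : Prop :=
  lattice_eq x y L /\ lattice_eq y x L.

Definition defined_by (tau : signature) (A : algebra tau)
    (Sigma : set (profinite_completion A * profinite_completion A)) :
    set (set A) :=
  [set L | Rec L /\ forall x y, Sigma (x, y) -> symmetric_lattice_eq x y L].

Record boolean_subalgebra (tau : signature) (A : algebra tau)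
    (B : set (set A)) : Prop := BooleanSubalgebra {
  bsub_rec : B `<=` @Rec tau A;
  bsub_set0 : B set0;
  bsub_setT : B setT;
  bsub_setU : forall K L, B K -> B L -> B (K `|` L);
  bsub_setI : forall K L, B K -> B L -> B (K `&` L);
  bsub_setC : forall L, B L -> B (~` L) }.

(* Main.v *)
Require Import Defs.
From mathcomp Require Import all_boot all_classical.

(** Two ideas carry the proof.

    First, points of the profinite completion and ultrafilters of subsets of
    [A] are the same thing as far as recognizable sets can tell: an ultrafilter
    [U] on [A] selects exactly one class of every finite-index congruence, these
    classes form a thread [x], and [U] agrees with [F_x] on [Rec A]
    ([ultrafilter_point]).  Thus the compactness of the completion enters only
    through the ultrafilter lemma.

    Second, a set [L] outside a field of sets [B] is separated from [B] by two
    ultrafilters which agree on [B] but not on [L] ([field_of_sets_separation]).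

    A Boolean subalgebra [B] is then defined by the set of all the equations
    [x <-> y] that hold on [B]: a recognizable set outside [B] violates the one
    given by the points of the two separating ultrafilters.  Conversely, for a
    fixed [x] and for recognizable sets, membership in [F_x] is evaluation at a
    representative of a single coordinate of [x] ([point_filter_repr]); it
    therefore commutes with the Boolean operations, so that the sets satisfying
    symmetric equations are closed under them. *)

Set Implicit Arguments.
Unset Strict Implicit.
Unset Printing Implicit Defensive.

Local Open Scope classical_set_scope.

Lemma ultrafilter_setC (X : Type) (U : set_system X) (L : set X) :
  UltraFilter U -> U (~` L) <-> ~ U L.
Proof.
move=> UU; split=> [UnL UL|nUL]; last by case: (in_ultra_setVsetC L UU).
by apply: (@filter_not_empty _ U _); rewrite -(setICr L); exact: filterI.
Qed.

Lemma ultrafilter_of_base (X I : Type) (D : set I) (F : I -> set X) :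
  D !=set0 ->
  (forall i j, D i -> D j -> exists2 k, D k & F k `<=` F i `&` F j) ->
  (forall i, D i -> F i !=set0) ->
  exists U : set_system X, UltraFilter U /\ forall i, D i -> U (F i).
Proof.
move=> D0 DI F0.
have PF := filter_from_proper (filter_from_filter D0 DI) F0.
have [U [UU FU]] := ultraFilterLemma PF.
by exists U; split=> // i Di; apply: FU; exists i.
Qed.

(** If none of the fibers were in [U], the finite intersection of their
    complements would be. *)
Lemma ultrafilter_finite_fiber (X T : Type) (f : X -> T) (U : set_system X) :
  UltraFilter U -> finite_set [set: T] -> exists c, U (f @^-1` [set c]).
Proof.
move=> UU /(@finite_seqP {classic T}) [s sE].
have : U (f @^-1` [set` s]) by rewrite -sE; exact: filterT.
elim: s {sE} => [|c s IHs] Us.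
  have [] := @filter_not_empty _ U _.
  by apply: filterS Us => a /=; rewrite in_nil.
have [|nUc] := in_ultra_setVsetC (f @^-1` [set c]) UU; first by exists c.
apply: IHs; apply: filterS (filterI Us nUc) => a /= [].
by rewrite inE => /orP[/eqP|].
Qed.

Section FieldOfSets.
Context (X : Type) (B : set (set X)).
Hypotheses (BT : B setT) (BI : forall K M, B K -> B M -> B (K `&` M)).
Hypothesis BC : forall K, B K -> B (~` K).

(** An ultrafilter is determined on [B] by containing the [B]-part of another
    one, because [B] is closed under complement. *)
Lemma ultrafilter_through (W : set_system X) (S : set X) :
  UltraFilter W -> (forall K, B K -> W K -> K `&` S !=set0) ->
  exists U : set_system X,
    [/\ UltraFilter U, U S & forall K, B K -> U K <-> W K].
Proof.
move=> UW meet.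
have [|K M [BK WK] [BM WM]|K []|U [UU WU]] := @ultrafilter_of_base X (set X)
  [set K | B K /\ W K] (fun K => K `&` S).
- by exists setT; split=> //; exact: filterT.
- exists (K `&` M); first by split; [exact: BI|exact: filterI].
  by move=> a [[Ka Ma] Sa]; split.
- exact: meet.
have US : U S.
  by rewrite -(setTI S); apply: WU; split=> //; exact: filterT.
have sub K : B K -> W K -> U K.
  move=> BK WK; have UKS : U (K `&` S) by exact: WU.
  by apply: filterS UKS => a [].
exists U; split=> // K BK; split=> [UK|]; last exact: sub.
apply: contrapT => /(ultrafilter_setC K UW) /(sub _ (BC BK)).
by move/(ultrafilter_setC K UU).
Qed.

(** The sets of [B] on which the trace of [L] is still in [B] form an ideal,
    which is proper when [L] is not in [B].  An ultrafilter avoiding this ideal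
    only meets [B] in sets that intersect both [L] and its complement, since a
    set of [B] missing either of them is in the ideal. *)
Lemma field_of_sets_separation (L : set X) : ~ B L ->
  exists U V : set_system X, [/\ UltraFilter U, UltraFilter V,
    forall K, B K -> U K <-> V K, U L & ~ V L].
Proof.
move=> nBL.
have B0 : B set0 by rewrite -setCT; exact: BC.
have BU K M : B K -> B M -> B (K `|` M).
  by move=> BK BM; rewrite -(setCK (_ `|` _)) setCU; apply/BC/BI; exact: BC.
have [|K M [BK BKL] [BM BML]|K [BK BKL]|W [UW DW]] := @ultrafilter_of_base X
  (set X) [set K | B K /\ B (~` K `&` L)] id.
- by exists setT; split=> //; rewrite setCT set0I.
- exists (K `&` M) => //; split; first exact: BI.
  by rewrite setCI setIUl; exact: BU.
- apply/set0P/eqP => K0; apply: nBL.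
  by move: BKL; rewrite K0 setC0 setTI.
have ideal K : B K -> W K -> ~ B (K `&` L).
  move=> BK WK BKL; apply: ((ultrafilter_setC K UW).1 _ WK).
  by apply: DW; split; [exact: BC|rewrite setCK].
have meetL K : B K -> W K -> K `&` L !=set0.
  move=> BK WK; apply/set0P/eqP => KL0.
  by apply: (ideal K BK WK); rewrite KL0.
have meetCL K : B K -> W K -> K `&` ~` L !=set0.
  move=> BK WK; apply/set0P/eqP => KL0; apply: (ideal K BK WK).
  by rewrite (setIidl _)//; apply/subsets_disjoint.
have [U [UU UL UE]] := ultrafilter_through UW meetL.
have [V [UV VL VE]] := ultrafilter_through UW meetCL.
exists U, V; split=> // [K BK|]; last exact/ultrafilter_setC.
by rewrite UE// VE.
Qed.

End FieldOfSets.

Section Recognizable.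
Context (tau : signature) (A : algebra tau).
Implicit Types (L K : set A) (theta : fin_congruence A)
  (x : profinite_completion A).

(** Recognizable sets are treated as the sets saturated under a finite-index
    congruence: unlike a presentation as a preimage, saturation passes to finer
    congruences and to Boolean combinations without changing any data. *)
Definition saturated theta L := forall a b, theta a b -> L a <-> L b.

Lemma saturated_preimage theta L : saturated theta L ->
  L = quot_map theta @^-1` [set C | L (quot_repr C)].
Proof.
move=> satL; apply/seteqP; split=> a /=;
  by apply: (satL _ _ _).1; apply/quot_map_eq; rewrite quot_reprK.
Qed.

Lemma kernel_fin_congruence (F : algebra tau) (phi : A -> F) :
  finite_algebra F -> is_hom phi ->
  exists theta, forall a b, theta a b <-> phi a = phi b.
Proof.
move=> finF hphi.
have compat (f : tau) (a b : 'I_(arity f) -> A) :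
    (forall i, phi (a i) = phi (b i)) -> phi (interp a) = phi (interp b).
  by move=> ab; rewrite !hphi; congr (interp _); exact/funext.
pose ker := @Congruence tau A (fun a b => phi a = phi b) (fun=> erefl)
  (fun _ _ => @esym _ _ _) (fun _ _ _ => @etrans _ _ _ _) compat.
suff fin : finite_algebra (quotient ker) by exists (FinCongruence fin).
have /(@finite_preimage (quotient ker) _ _ (fun C => phi (quot_repr C))) := finF.
rewrite preimage_setT; apply=> C D _ _ CD.
by rewrite -(quot_reprK C) -(quot_reprK D); apply/quot_map_eq.
Qed.

Lemma Rec_saturated L : Rec L <-> exists theta, saturated theta L.
Proof.
split=> [[F [phi [P [finF hphi ->]]]]|[theta satL]].
  have [theta thetaE] := kernel_fin_congruence finF hphi.
  by exists theta => a b /thetaE /= ->.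
exists (quotient theta), (quot_map theta), [set C | L (quot_repr C)].
split; [exact: fin_congrP|exact: quot_map_hom|exact: saturated_preimage].
Qed.

Lemma Rec_saturated2 K L : Rec K -> Rec L ->
  exists theta, saturated theta K /\ saturated theta L.
Proof.
move=> /Rec_saturated [theta satK] /Rec_saturated [theta' satL].
have [rho rhoE] := fin_congruenceI theta theta'.
by exists rho; split=> a b /rhoE []; [move=> /satK|move=> _ /satL].
Qed.

(** The right-hand side evaluates [L] at one element of [A], so it turns every
    Boolean operation on sets into the corresponding connective. *)
Lemma point_filter_repr x theta L : saturated theta L ->
  point_filter x L <-> L (quot_repr (coord x theta)).
Proof. by move=> /saturated_preimage {1}->; exact: point_filterE. Qed.

(** The selected classes form a thread because any two sets of an ultrafilter
    have a common element, and all the coordinates at stake can be read from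
    that element. *)
Lemma ultrafilter_point (U : set_system A) : UltraFilter U ->
  exists x, forall L, Rec L -> point_filter x L <-> U L.
Proof.
move=> UU.
have fiber theta : {C : quotient theta | U (quot_map theta @^-1` [set C])}.
  by apply: cid; apply: ultrafilter_finite_fiber; exact: fin_congrP.
have thread_fiber : is_thread (fun theta => proj1_sig (fiber theta)).
  move=> theta theta' sub.
  have [a [/= <- <-]] :=
    filter_ex (filterI (proj2_sig (fiber theta)) (proj2_sig (fiber theta'))).
  exact: transitionE.
pose x : profinite_completion A := exist _ _ thread_fiber.
exists x => L /Rec_saturated [theta satL].
rewrite (point_filter_repr x satL).
have classU := proj2_sig (fiber theta).
have rep a : quot_map theta a = coord x theta ->
    L a <-> L (quot_repr (coord x theta)).
  by move=> ax; apply/satL/quot_map_eq; rewrite quot_reprK.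
split=> [Lx|UL]; first by apply: filterS classU => a /rep ->.
by have [a [/rep <-]] := filter_ex (filterI classU UL).
Qed.

Lemma symmetric_lattice_eqP x y L :
  symmetric_lattice_eq x y L <-> (point_filter x L <-> point_filter y L).
Proof. by split=> [[yx xy]|[xy yx]]; split. Qed.

Lemma defined_by_boolean_subalgebra
    (Sigma : set (profinite_completion A * profinite_completion A)) :
  boolean_subalgebra (defined_by Sigma).
Proof.
(* A common congruence for K and L makes every truth-functional connective
   pass through point_filter at once. *)
have closed (op : Prop -> Prop -> Prop) K L :
    (forall p p' q q', (p <-> p') -> (q <-> q') -> (op p q <-> op p' q')) ->
    defined_by Sigma K -> defined_by Sigma L ->
    defined_by Sigma [set a | op (K a) (L a)].
  move=> opE [RK SK] [RL SL].
  have [theta [satK satL]] := Rec_saturated2 RK RL.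
  have sat : saturated theta [set a | op (K a) (L a)].
    by move=> a b ab; apply: opE; [exact: satK|exact: satL].
  split; first by apply/Rec_saturated; exists theta.
  move=> x y xy; apply/symmetric_lattice_eqP.
  rewrite !(point_filter_repr _ sat) /=.
  apply: opE; rewrite -!point_filter_repr//; apply/symmetric_lattice_eqP.
    exact: SK.
  exact: SL.
have def0 : defined_by Sigma set0.
  pose F := @Algebra tau unit (fun _ _ => tt).
  have R0 : @Rec tau A set0.
    by exists F, (fun=> tt), set0; split=> //; exact: finite_finset.
  have [theta sat0] := (Rec_saturated _).1 R0.
  split=> // x y _; apply/symmetric_lattice_eqP.
  by rewrite !(point_filter_repr _ sat0).
have defC L : defined_by Sigma L -> defined_by Sigma (~` L).
  move=> dL; apply: (closed (fun p _ => ~ p) L L) => // p p' _ _ pp' _.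
  by rewrite pp'.
split=> // [L []|||] //.
- by rewrite -setC0; exact: defC.
- by move=> K L; apply: (closed or) => p p' q q' -> ->.
- by move=> K L; apply: (closed and) => p p' q q' -> ->.
Qed.

End Recognizable.

Theorem corollary4p10 (tau : signature) (A : algebra tau) (B : set (set A))
    (hB : B `<=` @Rec tau A) :
  boolean_subalgebra B <->
  exists Sigma : set (profinite_completion A * profinite_completion A),
    B = defined_by Sigma.
Proof.
split=> [[_ _ BT _ BI BC]|[Sigma ->]]; last first.
  exact: defined_by_boolean_subalgebra.
exists [set xy | forall K, B K -> symmetric_lattice_eq xy.1 xy.2 K].
apply/seteqP; split=> [L BL|L [RL SL]].
  by split=> [|x y /(_ L BL)//]; exact: hB.
apply: contrapT => nBL.
have [U [V [UU UV UVE UL nVL]]] := field_of_sets_separation BT BI BC nBL.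
have [x xE] := ultrafilter_point UU.
have [y yE] := ultrafilter_point UV.
have [|_ yx] := SL x y.
  move=> K BK; apply/symmetric_lattice_eqP => /=.
  by rewrite xE ?yE; [exact: UVE|exact: hB..].
by apply/nVL/yE/yx/xE.
Qed.
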